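(* Every large even Artin group is poly-free.
   Context: Let $\Gamma$ be a finite simple graph with vertex set $V$ and edge set $E$, each edge $e=\{u,v\}$ carrying an integer label $m_e\ge 2$. The Artin group is $A_\Gamma=\langle V \mid {}_{m_e}(uv)={}_{m_e}(vu) \text{ for } e=\{u,v\}\in E\rangle$, where ${}_{m}(uv)$ denotes the alternating product $uvu\cdots$ of length $m$. $A_\Gamma$ is even if every label $m_e$ is even, and large if $m_e\ge 3$ for every $e\in E$. A group $G$ is poly-free if there is a chain of subgroups $1=G_0\unlhd G_1\unlhd\cdots\unlhd G_N=G$, each normal in the next, such that every quotient $G_{i+1}/G_i$ is a free group. *)

(* Defs.v *)
From mathcomp Require Import all_boot.
Set Implicit Arguments. Unset Strict Implicit. Unset Printing Implicit Defensive.

(** A word over generators X: letters (x, true) = x, (x, false) = x^-1. *)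
Definition word (X : Type) := seq (X * bool).

Definition wmul {X : Type} (w1 w2 : word X) : word X := w1 ++ w2.
Definition winv {X : Type} (w : word X) : word X :=
  rev (map (fun p => (p.1, ~~ p.2)) w).
Definition wone {X : Type} : word X := [::].

Inductive peq {X : Type} (R : word X -> word X -> Prop) : word X -> word X -> Prop :=
| peq_refl w : peq R w w
| peq_sym w1 w2 : peq R w1 w2 -> peq R w2 w1
| peq_trans w1 w2 w3 : peq R w1 w2 -> peq R w2 w3 -> peq R w1 w3
| peq_cancel (a c : word X) (x : X) (e : bool) :
    peq R (a ++ (x, e) :: (x, ~~ e) :: c) (a ++ c)
| peq_rel (a c l r : word X) : R l r -> peq R (a ++ l ++ c) (a ++ r ++ c).

(** Subgroups of the presented group <X | R>, as predicates on words that
    are invariant under the congruence. *)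
Definition subgroup {X : Type} (R : word X -> word X -> Prop)
    (H : word X -> Prop) : Prop :=
  [/\ (forall w1 w2, peq R w1 w2 -> H w1 -> H w2),
      H wone,
      (forall w1 w2, H w1 -> H w2 -> H (wmul w1 w2)) &
      (forall w, H w -> H (winv w))].

Definition normal_in {X : Type} (R : word X -> word X -> Prop)
    (H K : word X -> Prop) : Prop :=
  [/\ subgroup R H, subgroup R K,
      (forall w, H w -> K w) &
      (forall g h, K g -> H h -> H (wmul g (wmul h (winv g))))].

Fixpoint reduced {I : Type} (w : word I) : Prop :=
  match w with
  | x :: ((y :: _) as t) => ~ (x.1 = y.1 /\ x.2 = ~~ y.2) /\ reduced t
  | _ => True
  end.

Definition weval {X I : Type} (b : I -> word X) (w : word I) : word X :=
  flatten (map (fun p => if p.2 then b p.1 else winv (b p.1)) w).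

(** For H normal in K, the quotient K/H is a free group: there is a family
    (b i)_{i in I} of elements of K whose classes form a free basis of K/H,
    i.e. they generate K modulo H, and no nonempty freely reduced word in
    them lies in H. *)
Definition quotient_free {X : Type} (R : word X -> word X -> Prop)
    (H K : word X -> Prop) : Prop :=
  exists (I : Type) (b : I -> word X),
    [/\ (forall i, K (b i)),
        (forall g, K g -> exists w : word I, H (wmul g (winv (weval b w)))) &
        (forall w : word I, w <> [::] -> reduced w -> ~ H (weval b w))].

Definition poly_free {X : Type} (R : word X -> word X -> Prop) : Prop :=
  exists (N : nat) (G : nat -> word X -> Prop),
    [/\ (forall w, G 0 w <-> peq R w wone),
        (forall w, G N w),
        (forall i, i < N -> normal_in R (G i) (G i.+1)) &
        (forall i, i < N -> quotient_free R (G i) (G i.+1))].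

Definition alt {V : Type} (u v : V) (m : nat) : word V :=
  mkseq (fun i => if odd i then (v, true) else (u, true)) m.

Definition artin_rel {V : finType} (adj : rel V) (m : V -> V -> nat)
    (l r : word V) : Prop :=
  exists u v, adj u v /\ l = alt u v (m u v) /\ r = alt v u (m u v).

Definition labelled_simple_graph {V : finType} (adj : rel V)
    (m : V -> V -> nat) : Prop :=
  [/\ (forall u v, adj u v = adj v u), (forall u, ~~ adj u u),
      (forall u v, adj u v -> m u v = m v u) &
      (forall u v, adj u v -> 2 <= m u v)].

Definition artin_even {V : finType} (adj : rel V) (m : V -> V -> nat) : Prop :=
  forall u v, adj u v -> ~~ odd (m u v).

Definition artin_large {V : finType} (adj : rel V) (m : V -> V -> nat) : Prop :=
  forall u v, adj u v -> 3 <= m u v.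

(* Main.v *)
(** Let A = A_Gamma, and let v be a vertex. Since all labels are even, deleting
    v from words gives a retraction of A onto A' = A_(Gamma - v). Its kernel is
    generated by the conjugates c_g = g v g^-1, g in A', subject to
      c_(gu) c_(gu^2) ... c_(gu^k) = c_g c_(gu) ... c_(gu^(k-1))
    for u adjacent to v, where k = m_uv / 2 >= 2. For a free
    basis, every line g<u> keeps k consecutive generators and uses its relations
    to eliminate the others; one only needs that each c_g is eliminated at most
    once and that the elimination is well founded.

    The lines are controlled by letting A act on the Coxeter group W with two
    generators (u, true), (u, false) for each vertex u, in which (u, c) and
    (w, d) generate a dihedral group of order m_uw if c <> d and u, w are
    adjacent, and an infinite one otherwise: u sends x to x (u, c), where c is the
    parity of the length of x. The relators (uw)^(m_uw / 2) then act trivially.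
    Length on W is convex on lines, and an element of W has at most two right
    descents, of different colours c, because the nerve of W is a bipartite graph.
    For the same reason the word problem of W, by Tits' method of braid moves,
    needs no case of rank 3. *)
Require Import Defs.
From mathcomp Require Import all_boot zify.
From mathcomp Require Import boolp.
From Stdlib Require Import Setoid Morphisms.
Set Implicit Arguments. Unset Strict Implicit. Unset Printing Implicit Defensive.

(** * Presented groups and free reduction *)

Lemma winv_cat (X : Type) (x y : word X) : winv (x ++ y) = winv y ++ winv x.
Proof. by rewrite /winv map_cat rev_cat. Qed.

Lemma winvK (X : Type) (x : word X) : winv (winv x) = x.
Proof.
rewrite /winv map_rev revK -map_comp -[RHS]map_id; apply: eq_map => -[a e] /=.
by rewrite negbK.
Qed.

#[export] Hint Extern 0 (peq _ _ _) => exact: peq_refl : core.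

Section Presented.

Variables (X : Type) (R : word X -> word X -> Prop).
Implicit Types x y z : word X.

Lemma peq_ctx a c x y : peq R x y -> peq R (a ++ x ++ c) (a ++ y ++ c).
Proof.
elim=> [w|{}x {}y _|{}x {}y z _ IH1 _|a' c' s e|a' c' l r lr].
- exact: peq_refl.
- exact: peq_sym.
- exact: peq_trans IH1.
- rewrite -!catA /= !catA -catA; have := peq_cancel R (a ++ a') (c' ++ c) s e.
  by rewrite -!catA.
- by have := peq_rel (a ++ a') (c' ++ c) lr; rewrite -!catA.
Qed.

#[export] Instance peq_equiv : Equivalence (peq R).
Proof.
by split; [exact: peq_refl|exact: peq_sym|exact: peq_trans].
Qed.

#[export] Instance peq_cat : Proper (peq R ==> peq R ==> peq R) (@cat (X * bool)).
Proof.
move=> x x' xx' y y' yy'; transitivity (x' ++ y).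
  exact: (peq_ctx [::] y xx').
by have := peq_ctx x' [::] yy'; rewrite !cats0.
Qed.

Lemma mulwV x : peq R (x ++ winv x) [::].
Proof.
elim/last_ind: x => [|x [s e] IH]; first reflexivity.
rewrite -cats1 winv_cat -catA; etransitivity; last exact: IH.
exact: peq_cancel.
Qed.

Lemma mulVw x : peq R (winv x ++ x) [::].
Proof. by have := mulwV (winv x); rewrite winvK. Qed.

Lemma mulKw x y : peq R (winv x ++ x ++ y) y.
Proof. by rewrite catA mulVw. Qed.

Lemma mulVKw x y : peq R (x ++ winv x ++ y) y.
Proof. by rewrite catA mulwV. Qed.

Lemma mulwI x y z : peq R (x ++ y) (x ++ z) -> peq R y z.
Proof. by move=> E; rewrite -(mulKw x y) E mulKw. Qed.

Lemma mulIw x y z : peq R (y ++ x) (z ++ x) -> peq R y z.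
Proof.
by move=> E; rewrite -(cats0 y) -(mulwV x) catA E -catA mulwV cats0.
Qed.

#[export] Instance peq_winv : Proper (peq R ==> peq R) (@winv X).
Proof. by move=> x y E; apply: (@mulwI x); rewrite mulwV E mulwV. Qed.

End Presented.

Lemma weval_cat (X I : Type) (b : I -> word X) x y :
  weval b (x ++ y) = weval b x ++ weval b y.
Proof. by rewrite /weval map_cat flatten_cat. Qed.

Lemma weval_cons (X I : Type) (b : I -> word X) i e w :
  weval b ((i, e) :: w) = (if e then b i else winv (b i)) ++ weval b w.
Proof. by []. Qed.

Lemma weval_winv (X I : Type) (b : I -> word X) w :
  weval b (winv w) = winv (weval b w).
Proof.
elim: w => // -[i e] w IH.
rewrite weval_cons winv_cat -IH -cat1s winv_cat weval_cat; congr (_ ++ _).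
by case: e; rewrite /= /weval /= cats0 ?winvK.
Qed.

Lemma weval_ext (X : Type) (I : eqType) (b b' : I -> word X) (w : word I) :
  {in [seq p.1 | p <- w], b =1 b'} -> weval b w = weval b' w.
Proof.
move=> bb'; rewrite /weval; congr flatten; apply/eq_in_map => p pw.
by rewrite bb' //; apply: map_f.
Qed.

Lemma flatten_eq (X : Type) (I : eqType) (R : word X -> word X -> Prop)
    (a b : I -> word X) (s : seq I) :
  {in s, forall i, peq R (a i) (b i)} ->
  peq R (flatten [seq a i | i <- s]) (flatten [seq b i | i <- s]).
Proof.
elim: s => //= i s IH ab; rewrite (ab i (mem_head _ _)) IH // => j js.
by apply: ab; rewrite inE js orbT.
Qed.

Section FreeReduction.

Variable I : eqType.
Implicit Types w : word I.

Definition push (p : I * bool) w : word I :=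
  if w is q :: w' then
    if (p.1 == q.1) && (p.2 == ~~ q.2) then w' else p :: w
  else [:: p].

Definition free_reduce w : word I := foldr push [::] w.

Lemma reduced_behead p w : reduced (p :: w) -> reduced w.
Proof. by case: w => // q w []. Qed.

Lemma reduced_push p w : reduced w -> reduced (push p w).
Proof.
case: w => // q w rw; rewrite /push; case: ifP => [_|ne].
  exact: reduced_behead rw.
by split=> // -[e1 e2]; rewrite e1 e2 !eqxx in ne.
Qed.

Lemma pushK i e w : reduced w -> push (i, e) (push (i, ~~ e) w) = w.
Proof.
case: w => [|[j d] w] /=; first by rewrite !eqxx negbK eqxx.
case: (eqVneq i j) => [<-|nij] /=; last by rewrite eqxx negbK eqxx.
case: (eqVneq (~~ e) (~~ d)) => [/negb_inj<-|ned] /=; last by rewrite !eqxx negbK eqxx.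
case: w => [|[j' d'] w] //= [+ _].
case: (eqVneq i j') => [<-|] //=; case: (eqVneq e (~~ d')) => // -> []; split=> //.
Qed.

Lemma reduced_free_reduce w : reduced (free_reduce w).
Proof. by elim: w => //= p w IH; apply: reduced_push. Qed.

Lemma free_reduce_id w : reduced w -> free_reduce w = w.
Proof.
elim: w => //= p w IH rw; rewrite IH; last exact: reduced_behead rw.
case: w rw {IH} => //= q w [ne _]; case: ifP => // /andP[/eqP e1 /eqP e2].
by case: ne.
Qed.

(** Pushing a letter onto a reduced word is undone by pushing its inverse, so a cancelling pair does
    not change the fold. *)
Lemma free_reduce_peq w w' :
  peq (fun _ _ => False) w w' -> free_reduce w = free_reduce w'.
Proof.
elim=> // [x y z _ -> _ -> //|a c i e].
rewrite /free_reduce !foldr_cat /= pushK //; exact: reduced_free_reduce.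
Qed.

Lemma reduced_peq_nil w :
  w <> [::] -> reduced w -> ~ peq (fun _ _ => False) w [::].
Proof. by move=> w0 rw /free_reduce_peq; rewrite free_reduce_id. Qed.

End FreeReduction.

(** * Braid moves in a Coxeter system with triangle-free nerve *)

Record triangle_free_coxeter (S : eqType) (fin : rel S) (m : S -> S -> nat) : Prop := {
  coxeter_sym : forall s t, fin s t -> fin t s;
  coxeter_irr : forall s, ~~ fin s s;
  coxeter_triangle : forall r s t, fin r s -> fin s t -> ~~ fin r t;
  coxeter_label_sym : forall s t, fin s t -> m s t = m t s;
  coxeter_label_ge2 : forall s t, fin s t -> 1 < m s t }.

Section Braid.

Variables (S : eqType) (fin : rel S) (m : S -> S -> nat).
Hypothesis cox : triangle_free_coxeter fin m.

Let fin_sym s t : fin s t -> fin t s. Proof. exact: (coxeter_sym cox). Qed.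
Let fin_irr s : ~~ fin s s. Proof. exact: (coxeter_irr cox). Qed.
Let fin_triangle r s t : fin r s -> fin s t -> ~~ fin r t.
Proof. exact: (coxeter_triangle cox). Qed.
Let m_sym s t : fin s t -> m s t = m t s. Proof. exact: (coxeter_label_sym cox). Qed.
Let m_ge2 s t : fin s t -> 1 < m s t. Proof. exact: (coxeter_label_ge2 cox). Qed.

(* Words are stored with their last letter at the head, so that the right
   descents of an element are the heads of the words representing it. *)
Fixpoint altw (n : nat) (s t : S) : seq S :=
  if n is n'.+1 then s :: altw n' t s else [::].

Lemma size_altw n s t : size (altw n s t) = n.
Proof. by elim: n s t => //= n IH s t; rewrite IH. Qed.

Inductive bstep : seq S -> seq S -> Prop :=
| bstep_cons a x y : bstep x y -> bstep (a :: x) (a :: y)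
| bstep_head a b z : fin a b ->
    bstep (altw (m a b) a b ++ z) (altw (m a b) b a ++ z).

Inductive br (x : seq S) : seq S -> Prop :=
| br_refl : br x x
| br_step y z : bstep x y -> br y z -> br x z.
Hint Resolve br_refl : core.

Lemma bstep_sym x y : bstep x y -> bstep y x.
Proof.
elim=> [a {}x {}y _ IH|a b z ab]; first exact: bstep_cons.
by rewrite (m_sym ab); apply/bstep_head/fin_sym.
Qed.

Lemma br_trans y x z : br x y -> br y z -> br x z.
Proof. by elim=> // {}x {}y w xy _ IH /IH; apply: br_step. Qed.

Lemma br_sym x y : br x y -> br y x.
Proof.
elim=> // {}x {}y z xy _ IH; apply: br_trans IH _.
exact/(br_step (bstep_sym xy))/br_refl.
Qed.

Lemma br_cons a x y : br x y -> br (a :: x) (a :: y).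
Proof. by elim=> // {}x {}y z xy _; apply/br_step/bstep_cons. Qed.

Lemma br_catl p x y : br x y -> br (p ++ x) (p ++ y).
Proof. by elim: p => //= a p IH /IH; apply: br_cons. Qed.

Lemma br_head a b z : fin a b ->
  br (altw (m a b) a b ++ z) (altw (m a b) b a ++ z).
Proof. by move=> ab; apply: br_step (br_refl _); apply: bstep_head. Qed.

Lemma br_size x y : br x y -> size x = size y.
Proof.
elim=> // {}x {}y z xy _ <-; elim: xy => [a {}x {}y _ /= -> //|a b {}z _].
by rewrite !size_cat !size_altw.
Qed.

Lemma altwS n s t : altw n.+1 s t = s :: altw n t s.
Proof. by []. Qed.

Lemma altw_pred s t : fin s t -> altw (m s t) s t = s :: altw (m s t).-1 t s.
Proof. by move/m_ge2; case: (m s t). Qed.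

Lemma bstep_inv a x w : bstep (a :: x) w ->
  exists c x1, w = c :: x1 /\
  ((a = c /\ bstep x x1) \/
   (fin a c /\ exists z, x = altw (m a c).-1 c a ++ z /\
                         x1 = altw (m a c).-1 a c ++ z)).
Proof.
move E : (a :: x) => w0 st; case: st E => [b x' y st [-> ->]|b c z bc].
  by exists b, y; split=> //; left.
rewrite altw_pred //= => -[-> ->].
exists c, (altw (m b c).-1 b c ++ z); split.
  by rewrite (m_sym bc) altw_pred //; apply: fin_sym.
by right; split=> //; exists z.
Qed.

(** In the second case both words can be made to start with the longest element of the dihedral
    group of [a] and [b], followed by a common rest [z]. *)
Definition splits a x b y :=
  (a = b /\ br x y) \/
  (fin a b /\ exists z, br x (altw (m a b).-1 b a ++ z) /\
                        br y (altw (m a b).-1 a b ++ z)).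

(* The nerve of the Coxeter system has no triangle, so the rank 3 cases of
   the Brieskorn-Saito reduction lemma do not occur. *)
Lemma br_splits a x b y : br (a :: x) (b :: y) -> splits a x b y.
Proof.
have [n] := ubnP (size x); elim: n => // n IHn in a x b y *.
(* The outer induction on length gives cancellation in shorter words; the inner induction below
   follows the chain of braid moves. *)
have cancel p z z' : size (p ++ z) < n -> br (p ++ z) (p ++ z') -> br z z'.
  elim: p => //= c p IHp lt_n.
  have lt_n' : size (p ++ z) < n by lia.
  by case/IHn => [//|[_ /(IHp lt_n')]|[]] //; rewrite (negPf (fin_irr c)).
move=> lt_n; move Ew: (a :: x) => w; move Ew': (b :: y) => w' ww'.
elim: ww' a x lt_n Ew Ew' => [{}w|{}w w1 {}w' st ww' IH] a x lt_n Ew Ew'.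
  by left; move: Ew'; rewrite -Ew => -[-> ->].
move: st; rewrite -Ew => /bstep_inv[c [x1 [Ew1 Hc]]].
have sz1 : size x1 = size x.
  case: Hc => [[_ st]|[_ [z [-> ->]]]].
    by rewrite (@br_size x1 x) //; apply/br_sym/(br_step st).
  by rewrite !size_cat !size_altw.
have {}IH : splits c x1 b y by apply: IH; rewrite ?sz1.
case: Hc => [[eac st]|[ac [z [Ex Ex1]]]].
  subst c; case: IH => [[-> br1]|[ab [z [br1 br2]]]].
    by left; split=> //; apply: br_step br1.
  by right; split=> //; exists z; split=> //; apply: br_step br1.
case: IH => [[ecb br1]|[cb [z' [br1 br2]]]].
  subst c; right; split=> //; exists z; rewrite -Ex; split=> //.
  by rewrite -Ex1; apply: br_sym.
(* The head goes from [a] through [c] to [b]. If [b] is [a], the same alternating word is split off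
   twice and cancels; otherwise [a], [c], [b] would form a triangle in the nerve. *)
have [eab|nab] := eqVneq a b.
  subst b; left; split=> //; rewrite (m_sym cb) in br1 br2.
  have {}br1 : br z z'.
    have := m_ge2 ac; move: (sz1) (br1); rewrite Ex1 => + + m2.
    case: (m a c) m2 => [|[|k]] //= _ sz.
    case/IHn => [|[_ ]|[]]; rewrite ?(negPf (fin_irr a)) //; first lia.
    by apply: cancel; lia.
  by rewrite Ex; apply/br_sym/(br_trans br2)/br_catl/br_sym.
have := m_ge2 ac; have := m_ge2 cb; move: br1; rewrite Ex1 (m_sym cb).
move: sz1; rewrite Ex1; case: (m a c) => [|[|k]] //; case: (m b c) => [|[|k']] //=.
move=> sz1 + _ _; case/IHn => [|[/eqP]|[ab _]]; first lia.
  by rewrite (negPf nab).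
by case/negP: (fin_triangle ac cb).
Qed.

Lemma br_consI a x y : br (a :: x) (a :: y) -> br x y.
Proof. by case/br_splits => -[] //; rewrite (negPf (fin_irr a)). Qed.

Lemma br_catI p x y : br (p ++ x) (p ++ y) -> br x y.
Proof. by elim: p => //= a p IH /br_consI. Qed.

Lemma br_cons_neq a b x y : a != b -> br (a :: x) (b :: y) ->
  fin a b /\ exists z, br x (altw (m a b).-1 b a ++ z) /\
                       br y (altw (m a b).-1 a b ++ z).
Proof. by move=> /eqP ab /br_splits[[]|]. Qed.

(** * Reduced words and their descents *)

Definition red x := forall y p c q, br x y -> y <> p ++ c :: c :: q.

Definition desc s x := exists y, br x (s :: y).

Lemma red_nil : red [::].
Proof. by move=> y p c q /br_size; case: y p => // -[]. Qed.

Lemma red_br x y : br x y -> red x -> red y.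
Proof. by move=> xy rx z p c q yz; apply: (rx z p c q); apply: br_trans yz. Qed.

Lemma red_cat p x : red (p ++ x) -> red x.
Proof.
move=> rx y q c r xy Ey; apply: (rx (p ++ y) (p ++ q) c r); first exact: br_catl.
by rewrite Ey catA.
Qed.

Lemma red_cons a x : red (a :: x) -> red x.
Proof. exact: (@red_cat [:: a]). Qed.

Lemma red_cons2 a x : ~ red (a :: a :: x).
Proof. by move=> /(_ _ [::] a x (br_refl _)); apply. Qed.

Lemma desc_br s x y : br x y -> desc s x -> desc s y.
Proof. by move=> xy [z xz]; exists z; apply: br_trans xz; apply: br_sym. Qed.

Lemma desc_cons s x : desc s (s :: x). Proof. by exists x. Qed.

Lemma desc_fin s t x : s != t -> desc s x -> desc t x -> fin s t.
Proof.
move=> st [y xy] [z xz]; have := br_trans (br_sym xy) xz.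
by case/(br_cons_neq st).
Qed.

Lemma altw_add i j s t : altw (i + j) s t =
  altw i s t ++ (if odd i then altw j t s else altw j s t).
Proof.
elim: i s t => //= i IH s t; rewrite IH.
by case: odd.
Qed.

(** A descent [s] would make the word start with a full alternating word of length [m s t];
    cancelling [j] letters leaves [s] or [t] at the head of [z]. *)
Lemma altw_ascent s t z j : fin s t -> ~ desc s z -> ~ desc t z ->
  j < m s t -> ~ desc s (altw j t s ++ z).
Proof.
move=> st ns nt; case: j => //= j lt_j [y].
have nts : t != s by apply: contraTneq st => ->; rewrite (negPf (fin_irr s)).
case/(br_cons_neq nts) => ts [z' [+ _]].
have -> : (m t s).-1 = j + (m s t - j.+1) by rewrite m_sym //; lia.
rewrite altw_add -catA => /br_catI.
case: (m s t - j.+1) (subn_gt0 j.+1 (m s t)) => [|k _]; first by rewrite lt_j.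
by case: ifP => _ bz; [apply: nt|apply: ns]; eexists; exact: bz.
Qed.

(** A descent [s] or [b] of [z] either repeats the last letter of the alternating word, against
    reducedness, or completes it to the longest dihedral element, which can also start with [s]. *)
Lemma no_desc_tail s b x z : fin s b -> red x -> ~ desc s x ->
  br x (altw (m s b).-1 b s ++ z) -> ~ desc s z /\ ~ desc b z.
Proof.
move=> sb rx nx xz.
suff H c : (c == s) || (c == b) -> ~ desc c z by split; apply: H; rewrite eqxx ?orbT.
move=> cE [z' zz'].
have {xz zz'} xz : br x (altw (m s b).-1 b s ++ c :: z').
  by apply: br_trans xz _; apply: br_catl.
have [k mE] : exists k, m s b = k.+2.
  by exists (m s b).-2; have := m_ge2 sb; lia.
rewrite mE [k.+2.-1]/= in xz; have last_eq p q :
    altw k.+1 p q = altw k p q ++ [:: if odd k then q else p].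
  by rewrite -addn1 altw_add; case: ifP.
have [ec|nc] := eqVneq c (if odd k then s else b).
  by apply: (rx _ (altw k b s) c z' xz); rewrite last_eq -ec -catA.
have ec : c = if odd k then b else s.
  by case: odd nc cE => /negPf-> /=; rewrite ?orbF => /eqP.
apply: nx; exists (altw k.+1 b s ++ z').
apply: br_trans xz _; rewrite -cat_cons -altwS -mE.
apply: br_sym; apply: br_trans (br_head _ sb) _; rewrite mE.
have -> : altw k.+2 b s = altw k.+1 b s ++ [:: c].
  by rewrite -[in LHS](addn1 k.+1) altw_add ec /=; case: odd.
by rewrite -catA.
Qed.

(** A word in the class of [s :: x] with another head [b] starts with a long alternating word above
    some [z]. Building its tail on [z] letter by letter adds only ascents, so induction on the
    length applies. *)
Lemma red_ascent s x : red x -> ~ desc s x -> red (s :: x).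
Proof.
have [n] := ubnP (size x); elim: n => // n IHn in s x *.
move=> lt_n rx nx y p c q; case: y => [_|b y sxy]; first by case: p.
have [ebs|nbs] := eqVneq s b.
  subst b; move/br_consI: sxy => xy; case: p => [[Ec Ey]|d p [_ Ey]].
    by apply: nx; exists q; rewrite Ec -Ey.
  exact: (rx y p c q).
case/(br_cons_neq nbs): sxy => sb [z [xz yz]].
have bs := fin_sym sb.
have [nsz nbz] := no_desc_tail sb rx nx xz.
have rz : red z by apply: red_cat (red_br xz rx).
have szx : size x = (m s b).-1 + size z by rewrite (br_size xz) size_cat size_altw.
have alt_red j : j < m s b -> red (altw j s b ++ z) /\ red (altw j b s ++ z).
  elim: j => // j IHj lt_j; have [|r1 r2] := IHj; first exact: ltnW.
  have lt_j' := ltnW lt_j.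
  split=> /=; apply: IHn; rewrite ?size_cat ?size_altw //; try lia.
    exact: altw_ascent.
  by apply: altw_ascent; rewrite // m_sym.
have lt_m : (m s b).-1 < m s b by have := m_ge2 sb; lia.
have [ry _] := alt_red _ lt_m.
case: p => [[Ec Ey]|d p [_ Ey]]; last by apply: (ry y p c q) => //; apply: br_sym.
have : desc b (altw (m s b).-1 s b ++ z).
  by exists q; apply: br_trans (br_sym yz) _; rewrite Ec -Ey.
by apply: altw_ascent; rewrite ?(m_sym bs).
Qed.

Lemma desc_other a b x x' : a != b -> desc b x -> br x (a :: x') -> desc b x'.
Proof.
move=> ab [y xy] xx'.
have /(br_cons_neq ab)[fab [z [x'z _]]] := br_trans (br_sym xx') xy.
have [k mE] : exists k, m a b = k.+2.
  by exists (m a b).-2; have := m_ge2 fab; lia.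
by rewrite mE in x'z; eexists; exact: x'z.
Qed.

(** The letter [b] commutes with every letter of [A] but possibly the last: a longer dihedral
    relation would force two consecutive letters of [A] to coincide or to generate a finite
    group. *)
Lemma run_descent A b x y h : {in A &, forall a a', ~~ fin a a'} -> b \notin A ->
  red x -> br x (A ++ y) -> br x (b :: h) -> exists y', br h (A ++ y').
Proof.
elim: A x y h => [|a A IH] x y h nA bA rx xA xb; first by exists h.
have nab : a != b by apply: contraNneq bA => ->; rewrite mem_head.
have /(br_cons_neq nab)[fab [z [Az hz]]] := br_trans (br_sym xA) xb.
have rA : red (A ++ y) by apply: red_cons (red_br xA rx).
have [k mE] : exists k, m a b = k.+2.
  by exists (m a b).-2; have := m_ge2 fab; lia.
rewrite mE /= in Az hz.
have [y' ky'] : exists y', br (altw k a b ++ z) (A ++ y').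
  apply: IH rA (br_refl _) Az => [c c' cA c'A|].
    by apply: nA; rewrite inE ?cA ?c'A orbT.
  by apply: contra bA; rewrite inE orbC => ->.
case: k => [|k] in mE Az hz ky' *.
  by exists y'; apply: br_trans hz _; apply: br_cons.
clear IH; case: A => [|c A] in nA bA xA rA Az ky' *; first by eexists; exact: hz.
have [eca|nca] := eqVneq a c.
  by subst c; case: (@red_cons2 a (A ++ y)); apply: red_br xA rx.
have [ac _] := br_cons_neq nca ky'.
by have := nA a c; rewrite !inE !eqxx orbT ac => /(_ isT isT).
Qed.

(** Right multiplication by [s] in the Coxeter group. At a descent the shorter word is picked by
    choice, so identities hold in general only up to [br]. *)
Definition tog s x : seq S :=
  if pselect (desc s x) is left d then projT1 (cid d) else s :: x.

Lemma tog_desc s x : desc s x -> br x (s :: tog s x).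
Proof. by rewrite /tog; case: pselect => // d _; apply: projT2 (cid d). Qed.

Lemma tog_ndesc s x : ~ desc s x -> tog s x = s :: x.
Proof. by rewrite /tog; case: pselect. Qed.

Lemma size_tog_desc s x : desc s x -> size x = (size (tog s x)).+1.
Proof. by move=> /tog_desc/br_size. Qed.

Lemma tog_br s x y : br x y -> br (tog s x) (tog s y).
Proof.
move=> xy; have [d|nd] := pselect (desc s x).
  apply: (@br_consI s); apply: br_trans (br_sym (tog_desc d)) _.
  by apply: (br_trans xy); apply: tog_desc; apply: desc_br d.
rewrite !tog_ndesc //; first exact: br_cons.
by move/(desc_br (br_sym xy)).
Qed.

Lemma red_tog s x : red x -> red (tog s x).
Proof.
move=> rx; have [d|nd] := pselect (desc s x).
  exact: red_cons (red_br (tog_desc d) rx).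
by rewrite tog_ndesc //; apply: red_ascent.
Qed.

Lemma tog_ndesc_tog s x : red x -> desc s x -> ~ desc s (tog s x).
Proof.
move=> rx d [y dy]; apply: (@red_cons2 s y); apply: red_br rx.
exact: br_trans (tog_desc d) (br_cons _ dy).
Qed.

Lemma togK s x : red x -> br (tog s (tog s x)) x.
Proof.
move=> rx; have [d|nd] := pselect (desc s x).
  by rewrite (tog_ndesc (tog_ndesc_tog rx d)); apply/br_sym/tog_desc.
rewrite (tog_ndesc nd); apply: (@br_consI s).
exact/br_sym/tog_desc/desc_cons.
Qed.

Definition togs (L : seq S) x := foldl (fun x s => tog s x) x L.

Lemma togs_cat L L' x : togs (L ++ L') x = togs L' (togs L x).
Proof. exact: foldl_cat. Qed.

Lemma togs_br L x y : br x y -> br (togs L x) (togs L y).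
Proof. by elim: L x y => //= s L IH x y xy; apply/IH/tog_br. Qed.

Lemma red_togs L x : red x -> red (togs L x).
Proof. by elim: L x => //= s L IH x rx; apply/IH/red_tog. Qed.

Lemma togsK L x : red x -> br (togs (L ++ rev L) x) x.
Proof.
elim: L x => //= s L IH x rx; rewrite rev_cons -rcons_cat -cats1 togs_cat /=.
apply: br_trans (togK s rx); apply/tog_br/IH/red_tog/rx.
Qed.

Lemma altw_rcons n s t : altw n.+1 s t = rcons (altw n s t) (if odd n then t else s).
Proof. by rewrite -addn1 altw_add; case: odd; rewrite -cats1. Qed.

Lemma rev_altw n s t : rev (altw n s t) = if odd n then altw n s t else altw n t s.
Proof.
elim: n s t => // n IH s t.
by rewrite [in LHS]altwS rev_cons IH oddS if_neg !altw_rcons; case: odd.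
Qed.

Lemma togs_ascent s t z j : fin s t -> ~ desc s z -> ~ desc t z -> j <= m s t ->
  togs (altw j s t) z = rev (altw j s t) ++ z.
Proof.
move=> st ns nt; elim: j => // j IH lt_j.
rewrite altw_rcons -cats1 togs_cat IH 1?ltnW //= rev_cat /= tog_ndesc //.
rewrite rev_altw; case: odd; apply: altw_ascent => //; first exact: fin_sym.
by rewrite m_sym //; exact: fin_sym.
Qed.

Lemma togs_conj s t y n : odd n -> red y ->
  br (togs (altw n.+1 s t) y) y -> br (togs (altw n.+1 t s) y) y ->
  br (togs (altw n.+1 s t) (tog s y)) (tog s y) /\
  br (togs (altw n.+1 t s) (tog s y)) (tog s y).
Proof.
move=> on ry Hs Ht; split.
  rewrite altwS /=; apply: br_trans (togs_br _ (togK s ry)) _.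
  have := tog_br s Ht; rewrite altw_rcons on -cats1 togs_cat /= => Hst.
  by apply: br_trans Hst; apply/br_sym/togK/red_togs.
rewrite -[togs _ _]/(togs (altw n.+2 s t) y) altw_rcons oddS on -cats1 togs_cat.
exact: tog_br.
Qed.

(** Conjugation reduces this to the shortest element of a coset of the dihedral group. There the
    first half of the word climbs by the longest element, a braid move changes its expression, and
    the second half undoes the other climb. *)
Lemma togs_dihedral s t x : fin s t -> red x ->
  br (togs (altw (m s t + m s t) s t) x) x.
Proof.
move=> st; have [n] := ubnP (size x); elim: n => // n IHn in s t x st *.
move=> lt_n rx; have ts := fin_sym st.
have [k mE odk] : exists2 k, m s t + m s t = k.+1 & odd k.
  exists (m s t + m s t).-1; have := m_ge2 st; lia.
have conj a : desc a x -> red (tog a x) /\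
    [/\ br (togs (altw k.+1 s t) (tog a x)) (tog a x),
        br (togs (altw k.+1 t s) (tog a x)) (tog a x) &
        br x (tog a (tog a x))].
  move=> d; have ra := @red_tog a x rx.
  have lt_a : size (tog a x) < n by have := size_tog_desc d; lia.
  split=> //; split; [rewrite -mE|rewrite -mE (m_sym st)|exact/br_sym/togK];
    exact: IHn.
have [/conj[ry [Hs Ht xy]]|ns] := pselect (desc s x).
  have [H _] := togs_conj odk ry Hs Ht; rewrite mE.
  apply: br_trans (togs_br _ xy) _; apply: br_trans H _; exact: br_sym.
have [/conj[ry [Hs Ht xy]]|nt] := pselect (desc t x).
  have [_ H] := togs_conj odk ry Ht Hs; rewrite mE.
  apply: br_trans (togs_br _ xy) _; apply: br_trans H _; exact: br_sym.
rewrite altw_add -rev_altw togs_cat togs_ascent //.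
have /(togs_br (rev (altw (m s t) t s))) :
    br (rev (altw (m s t) s t) ++ x) (rev (altw (m s t) t s) ++ x).
  by rewrite !rev_altw; have := br_head x st; case: odd => // /br_sym.
move/br_trans; apply.
rewrite -togs_ascent -?(m_sym st) //.
by rewrite -togs_cat; apply: togsK.
Qed.

End Braid.

(** * The action of an even large Artin group on a Coxeter group *)

Lemma altS (V : Type) (u v : V) n : alt u v n.+1 = (u, true) :: alt v u n.
Proof.
rewrite /alt /mkseq /= -[1]addn0 iotaDl -map_comp; congr (_ :: _).
by apply: eq_map => i /=; case: odd.
Qed.

Lemma altSS (V : Type) (u v : V) n :
  alt u v (n.+1 + n.+1) = [:: (u, true), (v, true) & alt u v (n + n)].
Proof. by rewrite addSn addnS !altS. Qed.

Lemma alt_half (V : Type) (u v : V) n :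
  alt u v (n.+1 + n.+1) = alt u v (n + n) ++ [:: (u, true); (v, true)].
Proof. by elim: n => [|n IH] //; rewrite altSS {1}IH altSS. Qed.

Lemma all_alt (V : Type) (P : pred V) (u v : V) n : P u -> P v ->
  all (fun p => P p.1) (alt u v n).
Proof.
by move=> Pu Pv; elim: n u v Pu Pv => // n IH u v Pu Pv; rewrite altS /= Pu IH.
Qed.

Section Artin.

Variables (V : finType) (adj : rel V) (m : V -> V -> nat).
Hypothesis simple : labelled_simple_graph adj m.
Hypothesis even : artin_even adj m.
Hypothesis large : artin_large adj m.

Definition cox_fin : rel (V * bool) := fun s t => adj s.1 t.1 && (s.2 != t.2).
Definition cox_label (s t : V * bool) := (m s.1 t.1)./2.

Lemma half_label u v : adj u v -> m u v = (m u v)./2 + (m u v)./2 /\ 1 < (m u v)./2.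
Proof.
move=> uv; have := even uv; have := large uv; have := odd_double_half (m u v).
by case: odd => //; lia.
Qed.

Lemma artin_cox : triangle_free_coxeter cox_fin cox_label.
Proof.
have [sym irr msym _] := simple; split.
- by move=> [u c] [w d]; rewrite /cox_fin /= sym eq_sym.
- by move=> [u c]; rewrite /cox_fin /= eqxx andbF.
- move=> [u c] [w d] [x e]; rewrite /cox_fin /= => /andP[_ +] /andP[_].
  by case: c d e => [] [] [] //= _ _; rewrite andbF.
- by move=> [u c] [w d] /andP[/msym]; rewrite /cox_label /= => ->.
- by move=> [u c] [w d] /andP[/half_label[]].
Qed.

Notation brd := (@br _ cox_fin cox_label).
Notation dsc := (@desc _ cox_fin cox_label).
Notation tg := (@tog _ cox_fin cox_label).
Notation rd := (@red _ cox_fin cox_label).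
Notation artp := (peq (artin_rel adj m)).

(* Parity of the length decides which of the two involutions attached to a
   vertex acts, so that the vertex acts on lines with infinite orbits. *)
Definition act1 (x : seq (V * bool)) (p : V * bool) :=
  tg (p.1, odd (size x) == p.2) x.

Definition act x (w : word V) := foldl act1 x w.

Lemma act_cat x w w' : act x (w ++ w') = act (act x w) w'.
Proof. exact: foldl_cat. Qed.

Lemma odd_size_tog s x : odd (size (tg s x)) = ~~ odd (size x).
Proof.
have [d|nd] := pselect (dsc s x); last by rewrite (tog_ndesc nd).
by rewrite (size_tog_desc d) /= negbK.
Qed.

Lemma act1_br x y p : brd x y -> brd (act1 x p) (act1 y p).
Proof. by move=> xy; rewrite /act1 (br_size xy); apply: tog_br artin_cox _ _ _ _. Qed.

Lemma act_br x y w : brd x y -> brd (act x w) (act y w).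
Proof. by elim: w x y => //= p w IH x y xy; apply/IH/act1_br. Qed.

Lemma red_act x w : rd x -> rd (act x w).
Proof. by elim: w x => //= p w IH x rx; apply/IH/(red_tog artin_cox). Qed.

Lemma act1K x u e : rd x -> brd (act1 (act1 x (u, e)) (u, ~~ e)) x.
Proof.
move=> rx; rewrite /act1 /= odd_size_tog.
have -> : (~~ odd (size x) == ~~ e) = (odd (size x) == e) by case: odd; case: e.
exact: togK artin_cox _ _ rx.
Qed.

(** Each letter flips the parity, so [u] always acts with one colour and [w] with the other. *)
Lemma act_alt x u w n : act x (alt u w n) =
  togs cox_fin cox_label (altw n (u, odd (size x)) (w, ~~ odd (size x))) x.
Proof.
elim: n u w x => // n IH u w x.
rewrite altS /= IH odd_size_tog negbK.
by rewrite /act1 /= eqb_id.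
Qed.

Lemma act_relator x u w : rd x -> adj u w -> brd (act x (alt u w (m u w))) x.
Proof.
move=> rx uw; rewrite act_alt [m u w](half_label uw).1.
apply: togs_dihedral artin_cox _ _ _ _ rx.
by rewrite /cox_fin /= uw; case: odd.
Qed.

Lemma act_rel x w w' : rd x -> artp w w' -> brd (act x w) (act x w').
Proof.
have [sym irr msym _] := simple.
move=> rx ww'; elim: ww' => [y|y z _|y z t _ IH1 _ IH2|a c u e|a c l r].
- exact: br_refl.
- exact: (br_sym artin_cox).
- exact: (br_trans IH1).
- rewrite !act_cat /=; apply: act_br; apply: act1K; exact: red_act.
move=> [u [v [uv [-> ->]]]]; rewrite !act_cat; apply: act_br.
have rxa : rd (act x a) := red_act rx.
apply: (br_trans (act_relator rxa uv)); apply: (br_sym artin_cox).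
by rewrite (msym _ _ uv); apply: act_relator; rewrite // sym.
Qed.


(** * The rank of a group element and its descents *)

Definition rho (g : word V) := size (act [::] g).

Definition low (g : word V) u e := rho (g ++ [:: (u, e)]) < rho g.

Lemma red_orbit g : rd (act [::] g).
Proof. by apply/red_act/red_nil. Qed.

Lemma rho_rel g h : artp g h -> rho g = rho h.
Proof. by move=> gh; apply/br_size/act_rel => //; apply: red_nil. Qed.

Lemma low_rel g h u e : artp g h -> low g u e = low h u e.
Proof.
move=> gh; rewrite /low (rho_rel gh); congr (_ < _).
by apply: rho_rel; rewrite gh.
Qed.

Lemma act_snoc g u e :
  act [::] (g ++ [:: (u, e)]) = tg (u, odd (rho g) == e) (act [::] g).
Proof. by rewrite act_cat. Qed.

Lemma lowP g u e : reflect (dsc (u, odd (rho g) == e) (act [::] g)) (low g u e).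
Proof.
rewrite /low [rho (g ++ _)]/rho act_snoc; apply: (iffP idP) => [|d].
  move=> lt; have [//|nd] := pselect (dsc (u, odd (rho g) == e) (act [::] g)).
  by move: lt; rewrite (tog_ndesc nd) /= ltnNge leqnSn.
by rewrite -[ltnRHS]/(size (act [::] g)) (size_tog_desc d).
Qed.

Lemma rho_low g u e : low g u e -> (rho (g ++ [:: (u, e)])).+1 = rho g.
Proof. by move/lowP => d; rewrite [rho (g ++ _)]/rho act_snoc -(size_tog_desc d). Qed.

Lemma rho_nlow g u e : ~~ low g u e -> rho (g ++ [:: (u, e)]) = (rho g).+1.
Proof. by move/lowP => nd; rewrite [rho (g ++ _)]/rho act_snoc (tog_ndesc nd). Qed.

(** The sign [e] fixes the colour of the descent, and distinct descents have different colours. *)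
Lemma low_uniq g u w e : low g u e -> low g w e -> u = w.
Proof.
move=> /lowP du /lowP dw; apply: contrapT => nuw.
have /(desc_fin artin_cox) /(_ du dw) : (u, odd (rho g) == e) != (w, odd (rho g) == e).
  by apply: contra_not_neq nuw => -[].
by rewrite /cox_fin /= eqxx andbF.
Qed.

(** The two steps along a line use the two colours of [u], which generate an infinite dihedral group
    since no vertex is adjacent to itself. *)
Lemma low_nlow g u e : low g u e -> ~~ low g u (~~ e).
Proof.
move=> /lowP du; apply/lowP => dw.
have /(desc_fin artin_cox) /(_ du dw) : (u, odd (rho g) == e) != (u, odd (rho g) == ~~ e).
  by apply/eqP => -[]; case: odd; case: e {du dw}.
have [_ irr _ _] := simple.
by rewrite /cox_fin /= (negPf (irr u)).
Qed.

Lemma snocK g u e : artp ((g ++ [:: (u, e)]) ++ [:: (u, ~~ e)]) g.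
Proof. by rewrite -catA /= -[X in artp _ X]cats0; apply: peq_cancel. Qed.

Lemma snoc_low g u e : low (g ++ [:: (u, e)]) u (~~ e) = ~~ low g u e.
Proof.
rewrite /low (rho_rel (snocK g u e)).
by case: (boolP (low g u e)) => [/[dup] /rho_low <-|/rho_nlow ->]; rewrite /low; lia.
Qed.

(** The descent at [w] survives the step along [u], and it has the colour that a second lowering
    step along [u] would need. *)
Lemma low_apex g u w e : low g u e -> low g w (~~ e) ->
  ~~ low (g ++ [:: (u, e)]) u e.
Proof.
move=> lu lw; have odd_snoc : odd (rho (g ++ [:: (u, e)])) = ~~ odd (rho g).
  by rewrite -(rho_low lu) /= negbK.
have nwu : w != u by apply: contraTneq lw => ->; apply: low_nlow.
have [/lowP du /lowP dw] := (lu, lw).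
have ab : (u, odd (rho g) == e) != (w, odd (rho g) == ~~ e).
  by rewrite xpair_eqE eq_sym (negPf nwu).
have dw' := desc_other artin_cox ab dw (tog_desc du).
apply: contraNN nwu => /lowP; rewrite odd_snoc act_snoc => du'.
have [//|nwu] := eqVneq w u.
have /(desc_fin artin_cox) /(_ dw' du') :
    (w, odd (rho g) == ~~ e) != (u, ~~ odd (rho g) == e).
  by rewrite xpair_eqE (negPf nwu).
by rewrite /cox_fin /=; case: odd; case: (e); rewrite andbF.
Qed.

(* Eliminating c_g may use a generator of the same rank, two steps up a line
   from g; the longest suffix of g of the colour selecting descents in positive
   directions gets shorter along such steps (see run_snoc2). *)
Definition run n (g : word V) := exists A y,
  [/\ size A = n, {in A, forall a, a.2 = odd (rho g)} & brd (act [::] g) (A ++ y)].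

Lemma run0 g : run 0 g.
Proof. by exists [::], (act [::] g); split=> //; apply: br_refl. Qed.

Lemma run_le n g : run n g -> n <= rho g.
Proof. by case=> A [y [<- _ /br_size]]; rewrite /rho size_cat => ->; apply: leq_addr. Qed.

Lemma run_rel n g h : artp g h -> run n g -> run n h.
Proof.
move=> gh [A [y [szA redA gA]]]; exists A, y; split=> //; first by rewrite -(rho_rel gh).
apply: br_trans gA; apply: act_rel; last by symmetry.
exact: red_nil.
Qed.

(** The lowest point [h] of the line is covered by [g] and by [k] through the two colours of [u]. By
    [run_descent] the run of [k] is already a run at [h], and [g] prolongs it by a letter of the
    same colour. *)
Lemma run_snoc2 n g u : low g u true -> ~~ low (g ++ [:: (u, true)]) u true ->
  run n ((g ++ [:: (u, true)]) ++ [:: (u, true)]) -> run n.+1 g.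
Proof.
set h := g ++ _; set k := h ++ _ => lg lh.
have odk : odd (rho k) = odd (rho g).
  by rewrite /k (rho_nlow lh) -(rho_low lg).
have odh : odd (rho h) = ~~ odd (rho g) by rewrite -(rho_low lg) /= negbK.
case=> A [y [szA redA kA]]; rewrite odk in redA.
have gh : brd (act [::] g) ((u, odd (rho g)) :: act [::] h).
  move/lowP: lg; rewrite /h act_snoc => /tog_desc.
  by rewrite eqb_id.
have kh : brd (act [::] k) ((u, ~~ odd (rho g)) :: act [::] h).
  move/lowP: lh; rewrite /k act_snoc odh eqb_id => nd.
  by rewrite (tog_ndesc nd); apply: br_refl.
have [|||y' hA] := run_descent artin_cox _ _ _ kA kh.
- move=> a a' /redA aA /redA a'A; by rewrite /cox_fin aA a'A eqxx andbF.
- by apply/negP => /redA /=; case: odd.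
- exact: red_orbit.
exists ((u, odd (rho g)) :: A), y'; split; first by rewrite /= szA.
  by move=> a; rewrite inE => /predU1P[->|/redA].
by apply: br_trans gh _; apply: br_cons.
Qed.


(** * Lines through a group element *)

Definition pow (g : word V) u e n := g ++ nseq n (u, e).

Lemma pow0 g u e : pow g u e 0 = g. Proof. exact: cats0. Qed.

Lemma powS g u e n : pow g u e n.+1 = pow (g ++ [:: (u, e)]) u e n.
Proof. by rewrite /pow -catA. Qed.

Lemma powSr g u e n : pow g u e n.+1 = pow g u e n ++ [:: (u, e)].
Proof. by rewrite -addn1 /pow nseqD catA. Qed.

Lemma pow_pow g u e i j : pow (pow g u e i) u e j = pow g u e (i + j).
Proof. by rewrite /pow -catA nseqD. Qed.

Lemma pow_rel g h u e n : artp g h -> artp (pow g u e n) (pow h u e n).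
Proof. by move=> gh; rewrite /pow gh. Qed.

Lemma pow_back g u e n i : i <= n ->
  artp (pow (pow g u e n) u (~~ e) i) (pow g u e (n - i)).
Proof.
elim: i n => [|i IH] n; first by rewrite subn0 pow0.
case: n => // n; rewrite ltnS subSS => le_in.
rewrite powS powSr; apply: peq_trans (IH _ le_in).
exact/pow_rel/snocK.
Qed.

Lemma rho_up g u e n : ~~ low g u e -> rho (pow g u e n) = rho g + n.
Proof.
elim: n g => [|n IH] g ng; first by rewrite pow0 addn0.
rewrite powS IH; first by rewrite (rho_nlow ng) addSnnS.
by have := snoc_low g u e; rewrite ng => /low_nlow; rewrite negbK.
Qed.

Lemma low_up g u e n : ~~ low g u e -> low (pow g u e n.+1) u (~~ e).
Proof.
move=> ng; rewrite powSr snoc_low /low -powSr !rho_up //; lia.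
Qed.

Lemma rho_down g u e n : (forall i, i < n -> low (pow g u e i) u e) ->
  rho (pow g u e n) + n = rho g.
Proof.
elim: n => [|n IH] lown; first by rewrite pow0 addn0.
rewrite powSr addnS -addSn rho_low ?lown // IH // => i lt_i.
by apply: lown; apply: ltnW.
Qed.

Lemma line_bottom g u e : exists2 d, (forall i, i < d -> low (pow g u e i) u e) &
  ~~ low (pow g u e d) u e.
Proof.
have [n] := ubnP (rho g); elim: n => // n IHn in g *; move=> lt_n.
case: (boolP (low g u e)) => [lg|ng]; last by exists 0; rewrite // pow0.
have [|d Hd nd] := IHn (g ++ [:: (u, e)]); first by have := rho_low lg; lia.
exists d.+1; last by rewrite powS.
by case=> [|i] lt_i; [rewrite pow0|rewrite powS; apply: Hd].
Qed.

(** A canonical word for each group element, so that a generator indexed by an element becomes a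
    single letter. *)
Definition nrm (g : word V) : word V := choose (fun h => `[< artp g h >]) g.

Lemma nrmP g : artp g (nrm g).
Proof. by apply/asboolP/(@chooseP _ (fun h => `[< artp g h >]))/asboolP. Qed.

Lemma nrm_rel g h : artp g h -> nrm g = nrm h.
Proof.
move=> gh; rewrite /nrm; have E x : `[< artp g x >] = `[< artp h x >].
  by apply: asbool_equiv_eq; rewrite gh.
rewrite (eq_choose E); apply: choose_id; apply/asboolP => //; by symmetry.
Qed.

Lemma nrm_id g : nrm (nrm g) = nrm g.
Proof. by apply: nrm_rel; symmetry; apply: nrmP. Qed.

(** * Elimination of generators *)

Section Elimination.

Variables (L : pred V) (k : V -> nat).
Hypothesis k_ge2 : forall u, L u -> 1 < k u.

Definition slides u g := [forall i : 'I_(k u), low (pow g u false i) u false].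

Lemma slidesP u g :
  reflect (forall i, i < k u -> low (pow g u false i) u false) (slides u g).
Proof.
by apply: (iffP forallP) => [H i lt_i|H i]; [exact: (H (Ordinal lt_i))|exact: H].
Qed.

Definition letters (s : seq (word V)) : word (word V) := [seq (nrm h, true) | h <- s].

(* The formula for c_g coming from the relation of the line through g in the
   direction u whose other end is nearer to the lowest point of the line: go up
   if this lowers g, go down if k u steps down keep lowering g. The elements
   with sol g = None index the free basis. *)
Definition sol (g : word V) : option (word (word V)) :=
  if [pick u | L u && low g u true] is Some u then
    let p := letters [seq pow g u true i | i <- iota 1 (k u).-1] in
    Some (p ++ letters [:: pow g u true (k u)] ++ winv p)
  else if [pick u | L u && slides u g] is Some u then
    let p := letters [seq pow g u false (k u - i) | i <- iota 1 (k u).-1] in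
    Some (winv p ++ letters [:: pow g u false (k u)] ++ p)
  else None.

Lemma sol_None g : (forall u, L u -> ~~ low g u true /\ ~~ slides u g) -> sol g = None.
Proof.
move=> H; rewrite /sol; case: pickP => [u /andP[/H[/negPf-> _]] //|_].
by case: pickP => [u /andP[/H[_ /negPf->]]|].
Qed.

Definition dep (h g : word V) : bool :=
  if sol g is Some w then h \in [seq p.1 | p <- w] else false.

Lemma mem_letters h s :
  h \in [seq p.1 | p <- letters s] -> exists2 x, x \in s & h = nrm x.
Proof. by rewrite -map_comp => /mapP. Qed.

Lemma mem_winv (Y : eqType) (h : Y) (w : word Y) :
  (h \in [seq p.1 | p <- winv w]) = (h \in [seq p.1 | p <- w]).
Proof. by rewrite /winv map_rev mem_rev -map_comp. Qed.

Lemma dep_pow h g : dep h g -> exists u e i,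
  [/\ L u, 0 < i <= k u, h = nrm (pow g u e i) &
      if e then low g u true else slides u g].
Proof.
rewrite /dep /sol; case: pickP => [u /andP[Lu lu]|_].
  rewrite !map_cat !mem_cat mem_winv orbCA orbb orbC -mem_cat -map_cat -map_cat.
  move=> /mem_letters[x + ->]; rewrite -(map_cat _ _ [:: k u]) => /mapP[i].
  rewrite mem_cat mem_iota inE => Hi ->; exists u, true, i; split=> //.
  by have := k_ge2 Lu; lia.
case: pickP => [u /andP[Lu lu]|//].
rewrite !map_cat !mem_cat mem_winv orbCA orbb orbC -mem_cat -map_cat -map_cat.
move=> /mem_letters[x + ->]; rewrite mem_cat inE => /orP[/mapP[i]|/eqP->].
  rewrite mem_iota => Hi ->; exists u, false, (k u - i); split=> //.
  by have := k_ge2 Lu; lia.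
by exists u, false, (k u); rewrite leqnn; have := k_ge2 Lu; split=> //; lia.
Qed.

(** Here [b] is the bottom of the line. It is fewer than [k u] steps away, so no slide along [u] is
    long enough; being at least two steps above it excludes a lowering positive step by
    [low_apex]. *)
Lemma sol_far_up b u p : L u -> ~~ low b u true -> ~~ low b u false -> 1 < p < k u ->
  sol (nrm (pow b u true p)) = None.
Proof.
move=> Lu nt nf; case: p => [|[|p]] // lt_p.
set g := nrm _; have Eg : artp g (pow b u true p.+2) by symmetry; apply: nrmP.
have lg : low g u false by rewrite (low_rel _ _ Eg) low_up.
have nslide w : L w -> ~~ slides w g.
  move=> Lw; apply/negP => /slidesP sl.
  have wu : w = u.
    by apply: low_uniq lg; have := sl 0; rewrite pow0; apply; have := k_ge2 Lw; lia.
  subst w; have := sl p.+2; rewrite (@low_rel _ b); last first.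
    apply: peq_trans (pow_rel _ _ _ Eg) _.
    have := @pow_back b u true p.+2 p.+2 (leqnn _).
    by rewrite subnn pow0.
  by rewrite (negPf nf) => /(_ _)/negP; case/andP: lt_p => _ -> /(_ isT).
move=> *; apply: sol_None => w Lw; split; last exact: nslide.
apply/negP => lw; have := low_apex lg lw.
rewrite (@low_rel _ (pow b u true p.+1)); last first.
  by rewrite Eg powSr snocK.
by rewrite low_up.
Qed.

(** Induction on the rank, then on a bound for the run. A formula leads to a lower element, to one
    that is not eliminated, or to one of equal rank with a smaller bound on its run. *)
Lemma dep_wf : well_founded dep.
Proof.
suff H n g : rho g < n -> Acc dep g by move=> g; apply: (H (rho g).+1).
elim: n g => [|n IHn] g; first by rewrite ltn0.
rewrite ltnS leq_eqVlt => /predU1P[Eg|]; last exact: IHn.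
have nrun : ~ run n.+1 g by move/run_le; rewrite Eg ltnn.
elim: n.+1 g Eg nrun => [|j IHj] {}g Eg nrun; first by case: nrun; apply: run0.
constructor=> h /dep_pow[u [e [i [Lu Hi -> ]]]].
have rho_pow : rho (nrm (pow g u e i)) = rho (pow g u e i).
  by apply: rho_rel; symmetry; apply: nrmP.
case: e rho_pow => rho_pow => [lu|/slidesP sl]; last first.
  have : rho (pow g u false i) + i = rho g.
    by apply: rho_down => l lt_l; apply: sl; lia.
  by move=> rd; apply: IHn; lia.
(* Positive steps descend [d] times to the bottom of the line and then climb, so for [i > d] the
   rank is [rho g + i - 2 d]. *)
have [d Hd nd] := line_bottom g u true.
have d_gt0 : 0 < d by case: d Hd nd => //; rewrite pow0 lu.
have rho_d := rho_down Hd.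
have [le_id|lt_di] := leqP i d.
  have : rho (pow g u true i) + i = rho g.
    by apply: rho_down => l lt_l; apply: Hd; lia.
  by move=> rd; apply: IHn; lia.
have Ei : pow g u true i = pow (pow g u true d) u true (i - d).
  by rewrite pow_pow subnKC // ltnW.
have rho_i : rho (pow g u true i) + d + d = rho g + i.
  by rewrite Ei rho_up //; lia.
have nfd : ~~ low (pow g u true d) u false.
  case: d d_gt0 Hd {nd rho_d lt_di Ei rho_i} => // d _ Hd.
  by rewrite powSr snoc_low negbK Hd.
(* Two or more steps beyond the bottom, [sol_far_up] applies because [i - d < k u]. *)
have [le_i|lt_i] := leqP i d.+1; last first.
  by constructor=> h'; rewrite /dep Ei sol_far_up //; lia.
have {lt_di le_i} Ei1 : i = d.+1 by lia.
have [lt_d|le_d] := ltnP 1 d; first by apply: IHn; rewrite rho_pow; lia.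
(* The only case of equal rank: the bottom is one step away, and the generator lies one step beyond
   it. *)
have Ed : d = 1 by lia.
subst d i; apply: IHj; first by rewrite rho_pow; lia.
move=> rj; apply: nrun; apply: (@run_snoc2 _ _ u) => //.
apply: run_rel rj; symmetry.
rewrite -[X in artp X _]/(pow g u true 1 ++ [:: (u, true)]) -powSr.
exact: nrmP.
Qed.


(** * Line relations and elimination formulas in an arbitrary group *)

Section Solution.

Variables (Y : Type) (T : word Y -> word Y -> Prop) (c : word V -> word Y).
Hypothesis c_rel : forall g h, artp g h -> peq T (c g) (c h).

Definition block g u s n := flatten [seq c (pow g u true i) | i <- iota s n].

Lemma weval_letters s : peq T (weval c (letters s)) (flatten [seq c h | h <- s]).
Proof.
rewrite /weval /letters -map_comp; apply: flatten_eq => h _ /=.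
by apply: c_rel; symmetry; apply: nrmP.
Qed.

Lemma weval_block g u n (h : nat -> word V) :
  (forall i, 0 < i < n -> artp (h i) (pow g u true i)) ->
  peq T (weval c (letters [seq h i | i <- iota 1 n.-1])) (block g u 1 n.-1).
Proof.
move=> Eh; rewrite weval_letters -map_comp; apply: flatten_eq => i.
by rewrite mem_iota => Hi; apply/c_rel/Eh; lia.
Qed.

Lemma weval_letter h h' : artp h h' -> peq T (weval c (letters [:: h])) (c h').
Proof. by move=> hh'; rewrite weval_letters /= cats0; apply: c_rel. Qed.

Lemma block_recl g u s n : block g u s n.+1 = c (pow g u true s) ++ block g u s.+1 n.
Proof. by []. Qed.

Lemma block_recr g u s n : block g u s n.+1 = block g u s n ++ c (pow g u true (s + n)).
Proof. by rewrite /block -addn1 iotaD map_cat flatten_cat /= cats0. Qed.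

Lemma block_conj g u : L u ->
  peq T (block g u 1 (k u)) (block g u 0 (k u)) <->
  peq T (block g u 1 (k u).-1 ++ c (pow g u true (k u))) (c g ++ block g u 1 (k u).-1).
Proof.
move=> Lu; have := k_ge2 Lu; case: (k u) => // n _.
by rewrite block_recr add1n block_recl pow0.
Qed.

Lemma sol_up g u : L u -> low g u true -> sol (nrm g) =
  let p := letters [seq pow (nrm g) u true i | i <- iota 1 (k u).-1] in
  Some (p ++ letters [:: pow (nrm g) u true (k u)] ++ winv p).
Proof.
move=> Lu lu; have gn := nrmP g; rewrite /sol; case: pickP => [w /andP[_]|/(_ u)].
  by rewrite -(low_rel _ _ gn) => /(low_uniq lu) <-.
by rewrite Lu -(low_rel _ _ gn) lu.
Qed.

Lemma slide_up g u i n : ~~ low g u true -> i < n ->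
  low (pow (pow g u true n) u false i) u false.
Proof.
move=> nu lt_i; rewrite (low_rel _ _ (@pow_back g u true n i (ltnW lt_i))).
by rewrite -(subnSK lt_i) low_up.
Qed.

(** The choice of [u] is forced: a lowering positive step would by [low_apex] stop the slide after
    one step, whereas [k u] is at least 2, and a second slide direction contradicts [low_uniq]. *)
Lemma sol_down g u : L u -> ~~ low g u true -> sol (nrm (pow g u true (k u))) =
  let h := nrm (pow g u true (k u)) in
  let p := letters [seq pow h u false (k u - i) | i <- iota 1 (k u).-1] in
  Some (winv p ++ letters [:: pow h u false (k u)] ++ p).
Proof.
move=> Lu nu; set h := nrm _; have hE : artp h (pow g u true (k u)).
  by symmetry; apply: nrmP.
have k2 := k_ge2 Lu.
have slide i : i < k u -> low (pow h u false i) u false.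
  by move=> lt_i; rewrite (low_rel _ _ (pow_rel _ _ _ hE)) slide_up.
have lh : low h u false by have := slide 0; rewrite pow0; apply; lia.
rewrite /sol; case: pickP => [w /andP[_ lw]|_].
  by have := low_apex lh lw; rewrite (slide 1).
case: pickP => [w /andP[Lw /slidesP/(_ 0)]|/(_ u)].
  by rewrite pow0 => /(_ (ltnW (k_ge2 Lw)))/(low_uniq lh) <-.
by rewrite Lu; have /slidesP-> := slide.
Qed.

(** Each relation is the elimination of one of its extreme generators, the first if [u] lowers [g]
    and the last otherwise. This direction serves in the free group; the converse [relation_sol]
    serves for the conjugates of [v]. *)
Lemma sol_relation :
  (forall g w, sol (nrm g) = Some w -> peq T (c g) (weval c w)) ->
  forall g u, L u -> peq T (block g u 1 (k u)) (block g u 0 (k u)).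
Proof.
move=> Hsol g u Lu; apply/(block_conj g Lu); case: (boolP (low g u true)) => [lu|nu].
  have gn : artp (nrm g) g by symmetry; apply: nrmP.
  rewrite (Hsol _ _ (sol_up Lu lu)) !weval_cat weval_winv.
  rewrite (weval_letter (pow_rel _ _ _ gn)).
  rewrite (@weval_block g u) => [|i _]; last exact: pow_rel.
  by rewrite -!catA mulVw cats0.
have hE : artp (nrm (pow g u true (k u))) (pow g u true (k u)).
  by symmetry; apply: nrmP.
have back i : i <= k u ->
    artp (pow (nrm (pow g u true (k u))) u false (k u - i)) (pow g u true i).
  move=> le_i; apply: peq_trans (pow_rel _ _ _ hE) _.
  have := @pow_back g u true (k u) (k u - i) (leq_subr _ _).
  by rewrite subKn.
rewrite (Hsol _ _ (sol_down Lu nu)) !weval_cat weval_winv.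
rewrite (@weval_block g u) => [|i Hi]; last by apply: back; lia.
have := back 0 isT; rewrite subn0 pow0 => /weval_letter ->.
by rewrite mulVKw.
Qed.

Lemma relation_sol :
  (forall g u, L u -> peq T (block g u 1 (k u)) (block g u 0 (k u))) ->
  forall g w, sol g = Some w -> peq T (c g) (weval c w).
Proof.
move=> Hrel g w; rewrite /sol; case: pickP => [u /andP[Lu _] /Some_inj <-|_].
  have /(block_conj g Lu) E := Hrel g u Lu.
  rewrite !weval_cat weval_winv (weval_letter (peq_refl _ _)).
  rewrite (@weval_block g u) => [|i _]; last by [].
  by rewrite catA E -catA mulwV cats0.
case: pickP => [u /andP[Lu _] /Some_inj <-|//].
have back i : i <= k u ->
    artp (pow g u false (k u - i)) (pow (pow g u false (k u)) u true i).
  by move=> le_i; symmetry; apply: pow_back.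
have /(block_conj _ Lu) E := Hrel (pow g u false (k u)) u Lu.
rewrite !weval_cat weval_winv (weval_letter (peq_refl _ _)).
rewrite (@weval_block (pow g u false (k u)) u) => [|i Hi]; last by apply: back; lia.
rewrite -E; rewrite mulKw; apply: c_rel.
by have := back (k u) (leqnn _); rewrite subnn pow0.
Qed.

End Solution.


(** Formulas are substituted until only basis generators remain. The test [pselect] supplies the
    proof of [dep] for the recursion; its default [[::]] is never reached. *)
Definition fsolve : word V -> word (word V) :=
  Fix dep_wf (fun _ => word (word V)) (fun g rec =>
    if sol g is Some w then
      weval (fun h => if pselect (dep h g) is left hg then rec h hg else [::]) w
    else [:: (g, true)]).

Lemma fsolveE g : fsolve g = if sol g is Some w then weval fsolve w else [:: (g, true)].
Proof.
rewrite {1}/fsolve Fix_eq; last first.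
  move=> x f f' ff'; case: sol => // w; congr (weval _ w); apply: funext => h.
  by case: pselect.
rewrite -/fsolve; case E: (sol g) => [w|//]; apply: weval_ext => h hw.
by case: pselect => // -[]; rewrite /dep E.
Qed.

Lemma fsolve_relation g u : L u ->
  peq (fun _ _ => False) (block (fsolve \o nrm) g u 1 (k u))
                         (block (fsolve \o nrm) g u 0 (k u)).
Proof.
apply: sol_relation => [x y xy|x w xw] /=; first by rewrite (nrm_rel xy).
rewrite fsolveE xw (@weval_ext _ _ fsolve (fsolve \o nrm)) // => h hw /=.
have /dep_pow[y [e [i [_ _ -> _]]]] : dep h (nrm x) by rewrite /dep xw.
by rewrite nrm_id.
Qed.

End Elimination.

(** * Kernels of the retractions *)

Definition pr (P : pred V) (x : word V) : word V := [seq p <- x | P p.1].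

Lemma pr_cat P x y : pr P (x ++ y) = pr P x ++ pr P y.
Proof. exact: filter_cat. Qed.

Lemma pr_winv P x : pr P (winv x) = winv (pr P x).
Proof. by rewrite /pr /winv filter_rev filter_map. Qed.

Lemma pr_id (P : pred V) (x : word V) : all (fun p => P p.1) x -> pr P x = x.
Proof. by move/all_filterP. Qed.

Lemma pr_sub (P Q : pred V) x : subpred P Q -> pr P (pr Q x) = pr P x.
Proof.
move=> PQ; rewrite /pr -filter_predI; apply: eq_filter => p /=.
by case: (boolP (P p.1)) => // /PQ.
Qed.

Lemma all_pr (P : pred V) x : all (fun p => P p.1) (pr P x).
Proof. exact: filter_all. Qed.

Definition artin_sub (P : pred V) (l r : word V) :=
  artin_rel adj m l r /\ all (fun p => P p.1) l.

Lemma artin_sub_rel P x y : peq (artin_sub P) x y -> artp x y.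
Proof.
elim=> [w|x1 x2 _|x1 x2 x3 _ IH1 _|a c u e|a c l r [lr _]].
- by [].
- by symmetry.
- exact: peq_trans IH1.
- exact: peq_cancel.
- exact: peq_rel.
Qed.

Lemma pr_alt (P : pred V) u w n : pr P (alt u w (n + n)) =
  if P u then if P w then alt u w (n + n) else nseq n (u, true)
  else if P w then nseq n (w, true) else [::].
Proof.
elim: n => [|n IH]; first by case: (P u); case: (P w).
rewrite addSn addnS !altS /= -/(pr P) IH.
by case: (P u); case: (P w).
Qed.

(** Evenness makes both sides of a relator shrink to the same power when one of its vertices is
    deleted. *)
Lemma pr_peq P x y : artp x y -> peq (artin_sub P) (pr P x) (pr P y).
Proof.
have [sym irr msym _] := simple.
elim=> [w|x1 x2 _|x1 x2 x3 _ IH1 _|a c u e|a c l r].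
- by [].
- by symmetry.
- exact: peq_trans IH1.
- by rewrite !pr_cat /=; case: (P u) => //; apply: peq_cancel.
move=> [u [w [uw [-> ->]]]]; rewrite !pr_cat.
have [mE _] := half_label uw; have wu : adj w u by rewrite sym.
rewrite mE !pr_alt.
case Pu: (P u); case Pw: (P w) => //.
apply: peq_rel; rewrite -mE; split; first by exists u, w.
exact: all_alt.
Qed.

Section Kernel.

Variables (v : V) (P : pred V).
Hypothesis nPv : ~~ P v.

Let L u := adj v u && P u.
Let k u := (m v u)./2.

Let k_ge2 u : L u -> 1 < k u.
Proof. by case/andP => /half_label[]. Qed.

Let f := fsolve k_ge2 \o nrm.

(* A crossed homomorphism to the free group. It is meant for words over P and v:
   every letter outside P is read as v. *)
Fixpoint ev g (x : word V) : word (word V) :=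
  if x is (u, e) :: x' then
    if P u then ev (g ++ [:: (u, e)]) x'
    else (if e then f g else winv (f g)) ++ ev g x'
  else [::].

Lemma ev_cat g x y : ev g (x ++ y) = ev g x ++ ev (g ++ pr P x) y.
Proof.
elim: x g => [|[u e] x IH] g /=; first by rewrite cats0.
by case: ifP => Pu; rewrite IH -catA.
Qed.

Lemma ev_rel g h x : artp g h -> ev g x = ev h x.
Proof.
elim: x g h => //= -[u e] x IH g h gh.
rewrite /f /= (nrm_rel gh) (IH _ _ gh) (IH (g ++ _) (h ++ [:: (u, e)])) //.
by rewrite gh.
Qed.

Lemma ev_pr g x : all (fun p => P p.1) x -> ev g x = [::].
Proof. by elim: x g => //= -[u e] x IH g /andP[/= -> /IH]. Qed.

Lemma ev_alt g u n : P u ->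
  ev g (alt v u (n + n)) = block f g u 0 n /\ ev g (alt u v (n + n)) = block f g u 1 n.
Proof.
move=> Pu; elim: n => // n [IH0 IH1].
rewrite !alt_half !ev_cat IH0 IH1 !block_recr !pr_alt Pu (negPf nPv) /= Pu (negPf nPv).
by rewrite !cats0 add1n powSr; split.
Qed.

Definition keep (u : V) := P u || (u == v).

(** Relators inside [P] have empty value, and those between [v] and a vertex of [P] become the line
    relations of [fsolve_relation]. *)
Lemma ev_peq g x y : peq (artin_sub keep) x y -> peq (fun _ _ => False) (ev g x) (ev g y).
Proof.
have [sym irr msym _] := simple.
move=> xy; elim: xy g => {x y} [w|x y _ IH|x y z _ IH1 _ IH2|a c u e|a c l r lr] g.
- by [].
- by symmetry.
- exact: peq_trans (IH1 g) (IH2 g).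
- rewrite !ev_cat /=; case: (P u).
    rewrite (@ev_rel (_ ++ [:: (u, ~~ e)]) (g ++ pr P a)) //.
    by rewrite -!catA /= catA -[X in artp _ X]cats0; apply: peq_cancel.
  by case: e; rewrite /= ?mulVKw ?mulKw.
have lrA : artp l r.
  by have := peq_rel [::] [::] lr; rewrite !cats0 => /artin_sub_rel.
rewrite !ev_cat; apply: peq_cat => //; apply: peq_cat; last first.
  rewrite (@ev_rel _ ((g ++ pr P a) ++ pr P r)) //.
  by rewrite (artin_sub_rel (pr_peq P lrA)).
case: lr => -[u [w [uw [-> ->]]]].
have [mE mu] := half_label uw; have wu : adj w u by rewrite sym.
rewrite mE.
move=> keep_uw; have [ku kw] : keep u /\ keep w.
  by move: keep_uw; case: (_./2) mu => // n _; rewrite altSS /= => /and3P[].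
have wv_case x : adj v x -> P x ->
    peq (fun _ _ => False) (ev (g ++ pr P a) (alt x v ((m v x)./2 + (m v x)./2)))
                           (ev (g ++ pr P a) (alt v x ((m v x)./2 + (m v x)./2))).
  move=> vx Px; have [-> ->] := ev_alt (g ++ pr P a) (m v x)./2 Px.
  by apply: (@fsolve_relation L k k_ge2); rewrite /L vx Px.
case/orP: ku uw wu kw {keep_uw} => [Pu|/eqP->] uw wu /orP[Pw|/eqP Ew].
- by rewrite !ev_pr //; apply: all_alt.
- by subst w; rewrite (msym _ _ uw); apply: wv_case.
- by symmetry; apply: wv_case.
- by subst w; rewrite (negPf (irr _)) in uw.
Qed.

Definition vconj (g : word V) : word V := g ++ [:: (v, true)] ++ winv g.

Lemma conj_rel g h : artp g h -> artp (vconj g) (vconj h).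
Proof. by move=> gh; rewrite /vconj gh. Qed.

Lemma conjK g x : artp (vconj g ++ g ++ x) (g ++ [:: (v, true)] ++ x).
Proof. by rewrite /vconj -!catA mulKw. Qed.

(** Each factor [vconj h] turns a following [h] into [h] times [v], so the product telescopes. *)
Lemma block_conj0 g u n :
  artp (block vconj g u 0 n ++ pow g u true n) (g ++ alt v u (n + n)).
Proof.
elim: n => [|n IH]; first by rewrite /= pow0 cats0.
rewrite block_recr add0n powSr -catA conjK alt_half !catA -IH -!catA.
by [].
Qed.

Lemma block_conj1 g u n :
  artp (block vconj g u 1 n ++ pow g u true n) (g ++ alt u v (n + n)).
Proof.
elim: n => [|n IH]; first by rewrite /= pow0 cats0.
rewrite block_recr add1n -catA.
have := conjK (pow g u true n.+1) [::]; rewrite cats0 => ->.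
by rewrite powSr alt_half [in X in artp _ X]catA -IH -!catA.
Qed.

Lemma conj_relation g u : L u -> artp (block vconj g u 1 (k u)) (block vconj g u 0 (k u)).
Proof.
case/andP=> vu _; have [mE _] := half_label vu.
apply: (@mulIw _ _ (pow g u true (k u))); rewrite block_conj0 block_conj1 -mE.
apply: peq_cat => //; symmetry.
have rvu : artin_rel adj m (alt v u (m v u)) (alt u v (m v u)) by exists v, u.
by have := peq_rel [::] [::] rvu; rewrite !cats0.
Qed.

Definition basis_word (g : word V) : bool :=
  [&& sol L k g == None, nrm g == g & `[< artp (pr P g) g >]].

(** The canonical word of an element need not be spelled over [P]; projecting it gives words
    literally over [P] and [v]. *)
Definition basis (i : {g | basis_word g}) : word V := vconj (pr P (val i)).

Definition spanned x := exists w, artp x (weval basis w).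

Lemma spanned_rel x y : artp x y -> spanned x -> spanned y.
Proof. by move=> xy [w xw]; exists w; rewrite -xy. Qed.

Lemma spanned_cat x y : spanned x -> spanned y -> spanned (x ++ y).
Proof. by move=> [w xw] [w' yw']; exists (w ++ w'); rewrite weval_cat xw yw'. Qed.

Lemma spanned_winv x : spanned x -> spanned (winv x).
Proof. by move=> [w xw]; exists (winv w); rewrite weval_winv xw. Qed.

Lemma spanned_nil : spanned [::]. Proof. by exists [::]. Qed.

Lemma pr_rel x y : artp x y -> artp (pr P x) (pr P y).
Proof. by move/(pr_peq P)/artin_sub_rel. Qed.

(** Induction along [dep]: the formula of an eliminated conjugate holds in the Artin group, and its
    steps use only vertices of [P]. *)
Lemma spanned_nrm h : nrm h = h -> artp (pr P h) h -> spanned (vconj h).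
Proof.
elim: {h}(dep_wf k_ge2 h) => h _ IH hn hP; case E: (sol L k h) => [w|]; last first.
  have hb : basis_word h by rewrite /basis_word E hn !eqxx; apply/asboolP.
  exists [:: (exist _ h hb, true)]; rewrite /weval /= cats0 /basis /=.
  exact/conj_rel/peq_sym.
have /peq_sym/spanned_rel := relation_sol k_ge2 conj_rel conj_relation E; apply.
have: {in [seq p.1 | p <- w], forall h', spanned (vconj h')}.
  move=> h' hw; have /[dup] hh' : dep L k h' h by rewrite /dep E.
  case/(dep_pow k_ge2) => u [e [i [Lu _ Eh' _]]].
  apply: IH => //; first by rewrite Eh' nrm_id.
  have PE : artp (pr P (pow h u e i)) (pow h u e i).
    rewrite /pow pr_cat hP (@pr_id _ (nseq _ _)) // all_nseq /=.
    by case/andP: Lu => _ ->; rewrite orbT.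
  have En : artp h' (pow h u e i) by rewrite Eh'; symmetry; apply: nrmP.
  by apply: peq_trans (pr_rel En) _; apply: peq_trans PE _; symmetry.
elim: w {E} => [|[h' e] w IHw] Hw; first exact: spanned_nil.
rewrite weval_cons; apply: spanned_cat.
  have := Hw h' (mem_head _ _); case: (e) => //; exact: spanned_winv.
by apply: IHw => h'' hw; apply: Hw; rewrite inE hw orbT.
Qed.

Lemma spanned_conj g : all (fun p => P p.1) g -> spanned (vconj g).
Proof.
move=> Pg; have gn := nrmP g; apply: (@spanned_rel (vconj (nrm g))).
  exact/conj_rel/peq_sym.
apply: spanned_nrm; first exact: nrm_id.
by apply: peq_trans (pr_rel (peq_sym gn)) _; rewrite pr_id.
Qed.

(** As in Reidemeister-Schreier rewriting, each [v] in [x] contributes its conjugate by the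
    projection of the prefix before it. *)
Lemma spanned_kernel x : all (fun p => keep p.1) x -> artp (pr P x) [::] -> spanned x.
Proof.
move=> kx px; suff [s [ss xs]] : exists s, spanned s /\ artp x (s ++ pr P x).
  by apply: (spanned_rel _ ss); rewrite xs px cats0.
elim/last_ind: x kx {px} => [|x [u e] IH].
  by exists [::]; split=> //; apply: spanned_nil.
rewrite -cats1 all_cat /= andbT => /andP[/IH[s [ss xs]] /orP[Pu|/eqP->]].
  by exists s; split=> //; rewrite pr_cat /= Pu catA -xs.
exists (s ++ if e then vconj (pr P x) else winv (vconj (pr P x))); split.
  apply: spanned_cat => //; have := spanned_conj (all_pr P x).
  by case: (e) => //; exact: spanned_winv.
rewrite pr_cat /= (negPf nPv) cats0 {1}xs -!catA; apply: peq_cat => //.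
case: e; first by have := conjK (pr P x) [::]; rewrite cats0 => ->.
rewrite /vconj !winv_cat winvK -!catA.
by rewrite mulVw cats0.
Qed.

Lemma all_basis i : all (fun p => keep p.1) (basis i).
Proof.
rewrite /basis /vconj all_cat /= /keep eqxx orbT /= -pr_winv.
by rewrite !(sub_all _ (all_pr P _)) // => p /= ->.
Qed.

Lemma all_weval w : all (fun p => keep p.1) (weval basis w).
Proof.
elim: w => // -[i e] w IH; rewrite weval_cons all_cat IH andbT.
by case: e; rewrite ?all_basis // /winv all_rev all_map all_basis.
Qed.

Lemma pr_basis i : artp (pr P (basis i)) [::].
Proof.
rewrite /basis /vconj pr_cat /= (negPf nPv) pr_winv pr_id ?all_pr //.
exact: mulwV.
Qed.

Lemma ev_basis i : ev [::] (basis i) = [:: (val i, true)].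
Proof.
case: i => g gb; have /and3P[/eqP gsol /eqP gn /asboolP gP] := gb.
rewrite /basis /vconj /=.
rewrite ev_cat /= (negPf nPv) !ev_pr ?all_pr -?pr_winv ?all_pr //=.
rewrite cats0 pr_id ?all_pr // /f /= (nrm_rel gP) gn.
by rewrite fsolveE gsol.
Qed.

Lemma ev_weval w : peq (fun _ _ => False) (ev [::] (weval basis w))
  [seq (val p.1, p.2) | p <- w].
Proof.
elim: w => // -[i e] w IH; rewrite weval_cons ev_cat /=.
rewrite (@ev_rel _ [::]); last by case: e; rewrite ?pr_winv pr_basis.
rewrite IH -cat1s; apply: peq_cat => //; case: e; first by rewrite ev_basis.
(* The value at an inverse follows from the cocycle rule for [basis i ++ winv (basis i)]. *)
apply: (@mulwI _ _ (ev [::] (basis i))).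
rewrite -[in ev _ (winv _)](@ev_rel (pr P (basis i))); last exact: pr_basis.
rewrite -[pr P _]cat0s -ev_cat ev_basis.
have /(ev_peq [::]) -> : peq (artin_sub keep) (basis i ++ winv (basis i)) [::].
  exact: mulwV.
by symmetry; apply: (peq_cancel _ [::] [::]).
Qed.

Lemma basis_free w : w <> [::] -> reduced w -> ~ artp (pr keep (weval basis w)) [::].
Proof.
move=> w0 rw /(pr_peq keep); rewrite !(pr_id (all_weval w)) => /(ev_peq [::]).
rewrite ev_weval; apply: reduced_peq_nil; first by case: w w0 {rw}.
elim: w rw {w0} => // p [|q w] IH //= [pq rw]; split; last exact: IH.
by case=> e1 e2; apply: pq; split=> //; apply: val_inj.
Qed.

End Kernel.

(** * The chain of kernels *)

Definition tail i : pred V := fun u => i <= index u (enum V).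

Definition kernel i : word V -> Prop := fun w => artp (pr (tail i) w) [::].

Lemma kernel_subgroup i : subgroup (artin_rel adj m) (kernel i).
Proof.
split=> [w w' ww'||w w'|w] //; rewrite /kernel.
- move=> <-; symmetry; apply: artin_sub_rel; exact: pr_peq.
- by rewrite /wmul pr_cat => -> ->.
- by rewrite pr_winv => ->.
Qed.

Lemma kernel_succ i w : kernel i w -> kernel i.+1 w.
Proof.
rewrite /kernel => /(pr_peq (tail i.+1))/artin_sub_rel.
by rewrite pr_sub // => u /ltnW.
Qed.

Lemma kernel_normal i : normal_in (artin_rel adj m) (kernel i) (kernel i.+1).
Proof.
split; [exact: kernel_subgroup|exact: kernel_subgroup|exact: kernel_succ|].
move=> g h _; rewrite /kernel /wmul !pr_cat pr_winv => ->.
exact: mulwV.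
Qed.

(** Projection onto [tail i] identifies the quotient with the kernel of the retraction that deletes
    the [i]-th vertex from [tail i]. *)
Lemma kernel_quotient i : i < #|V| ->
  quotient_free (artin_rel adj m) (kernel i) (kernel i.+1).
Proof.
move=> lt_i; have [v0] : exists v : V, true.
  by move: lt_i; case: (pickP V) => [v0 _|/eq_card0->] //; exists v0.
move=> _; set v := nth v0 (enum V) i.
have iv : index v (enum V) = i by rewrite index_uniq ?enum_uniq // -cardE.
have nPv : ~~ tail i.+1 v by rewrite /tail iv ltnn.
have keepE : keep v (tail i.+1) =1 tail i.
  move=> u; rewrite /keep /tail [in RHS]leq_eqVlt orbC; congr (_ || _).
  rewrite -{1}iv; apply/eqP/eqP => [->//|uv].
  by rewrite -(nth_index v0 (mem_enum V u)) -uv nth_index ?mem_enum.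
have prE x : pr (tail i) x = pr (keep v (tail i.+1)) x.
  by apply: eq_filter => p; rewrite keepE.
exists _, (@basis v (tail i.+1)); split.
- exact: pr_basis.
- move=> g Kg; have [||w gw] := @spanned_kernel v _ nPv (pr (tail i) g).
  + by rewrite prE all_pr.
  + by rewrite pr_sub // => u /ltnW.
  exists w; rewrite /kernel /wmul pr_cat pr_winv gw [pr _ (weval _ _)]prE.
  by rewrite (pr_id (all_weval w)) mulwV.
- by move=> w w0 rw; rewrite /kernel prE; apply: basis_free.
Qed.

End Artin.

Theorem theoremA (V : finType) (adj : rel V) (m : V -> V -> nat) :
  labelled_simple_graph adj m ->
  artin_even adj m -> artin_large adj m ->
  poly_free (artin_rel adj m).
Proof.
move=> simple even large; exists #|V|, (kernel adj m); split.
- by move=> w; rewrite /kernel pr_id //; apply/allP.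
- move=> w; rewrite /kernel (_ : pr _ w = [::]) //.
  apply/eqP; rewrite -(negbK (_ == _)) -has_filter; apply/hasPn => p _.
  by rewrite /tail -ltnNge cardE index_mem mem_enum.
- by move=> i _; apply: kernel_normal.
- by move=> i; apply: kernel_quotient.
Qed.
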